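(* Let $G$ be a dense subgroup of a Hausdorff topological group $H$. If $G$ is a Lindelöf $\Sigma$-space, then $w(H)=w(G)\leq\psi(G)^\omega$.
   Context: $w$ weight, $\psi$ pseudocharacter. The Nagami number $Nag(Y)$ of a Tychonoff space $Y$ is the minimal cardinality of a family $\mathcal F$ of closed subsets of $\beta Y$ such that for every $y\in Y$ and $z\in\beta Y\setminus Y$ there is $F\in\mathcal F$ with $y\in F$, $z\notin F$; $Y$ is a Lindelöf $\Sigma$-space if $Nag(Y)\leq\omega$. *)

(* Defs.v *)
From Stdlib Require Import List.

Definition topology (X : Type) := (X -> Prop) -> Prop.

Definition is_topology {X : Type} (T : topology X) : Prop :=
  T (fun _ => True) /\
  (forall U V, T U -> T V -> T (fun x => U x /\ V x)) /\
  (forall F : (X -> Prop) -> Prop, (forall U, F U -> T U) ->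
     T (fun x => exists U, F U /\ U x)).

Definition closed {X : Type} (T : topology X) (A : X -> Prop) : Prop :=
  T (fun x => ~ A x).

Definition continuous {X Y : Type} (TX : topology X) (TY : topology Y)
  (f : X -> Y) : Prop :=
  forall V, TY V -> TX (fun x => V (f x)).

Definition hausdorff {X : Type} (T : topology X) : Prop :=
  forall x y, x <> y -> exists U V, T U /\ T V /\ U x /\ V y /\
    (forall z, U z -> V z -> False).

Definition compact {X : Type} (T : topology X) : Prop :=
  forall F : (X -> Prop) -> Prop, (forall U, F U -> T U) ->
    (forall x, exists U, F U /\ U x) ->
    exists l : list (X -> Prop), (forall U, In U l -> F U) /\
      (forall x, exists U, In U l /\ U x).

Definition dense {X : Type} (T : topology X) (A : X -> Prop) : Prop :=
  forall U, T U -> (exists x, U x) -> exists x, U x /\ A x.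

Definition subspace {X : Type} (T : topology X) (A : X -> Prop)
  : topology {x : X | A x} :=
  fun U => exists V, T V /\ forall x : {x : X | A x}, U x <-> V (proj1_sig x).

Definition product_top {X Y : Type} (TX : topology X) (TY : topology Y)
  : topology (X * Y) :=
  fun W => forall p, W p -> exists U V, TX U /\ TY V /\ U (fst p) /\ V (snd p) /\
    (forall q, U (fst q) -> V (snd q) -> W q).

Definition embedding {X Y : Type} (TX : topology X) (TY : topology Y)
  (e : X -> Y) : Prop :=
  (forall x y, e x = e y -> x = y) /\ continuous TX TY e /\
  (forall U, TX U -> exists V, TY V /\ forall x, U x <-> V (e x)).

Definition stone_cech {Y K : Type} (TY : topology Y) (TK : topology K)
  (e : Y -> K) : Prop :=
  is_topology TK /\ compact TK /\ hausdorff TK /\ embedding TY TK e /\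
  dense TK (fun z => exists y, e y = z) /\
  (forall (Z : Type) (TZ : topology Z), is_topology TZ -> compact TZ ->
     hausdorff TZ -> forall f : Y -> Z, continuous TY TZ f ->
     exists F : K -> Z, continuous TK TZ F /\ forall y, F (e y) = f y).

Definition lindelof_sigma {Y : Type} (TY : topology Y) : Prop :=
  exists (K : Type) (TK : topology K) (e : Y -> K), stone_cech TY TK e /\
  exists F : nat -> (K -> Prop), (forall n, closed TK (F n)) /\
    forall (y : Y) (z : K), ~ (exists y', e y' = z) ->
      exists n, F n (e y) /\ ~ F n z.

Definition injective {A B : Type} (f : A -> B) : Prop :=
  forall a b, f a = f b -> a = b.

Definition weight_le {X : Type} (T : topology X) (K : Type) : Prop :=
  exists (I : Type) (B : I -> (X -> Prop)),
    (forall i, T (B i)) /\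
    (forall U, T U -> forall x, U x -> exists i, B i x /\ forall y, B i y -> U y) /\
    exists f : I -> K, injective f.

Definition psi_le {X : Type} (T : topology X) (K : Type) : Prop :=
  forall x : X, exists (I : Type) (U : I -> (X -> Prop)),
    (forall i, T (U i) /\ U i x) /\
    (forall y, (forall i, U i y) -> y = x) /\
    exists f : I -> K, injective f.

Definition is_group {H : Type} (mul : H -> H -> H) (inv : H -> H) (one : H) : Prop :=
  (forall a b c, mul a (mul b c) = mul (mul a b) c) /\
  (forall a, mul one a = a) /\ (forall a, mul a one = a) /\
  (forall a, mul (inv a) a = one) /\ (forall a, mul a (inv a) = one).

Definition is_topological_group {H : Type} (T : topology H)
  (mul : H -> H -> H) (inv : H -> H) (one : H) : Prop :=
  is_topology T /\ is_group mul inv one /\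
  continuous (product_top T T) T (fun p => mul (fst p) (snd p)) /\
  continuous T T inv.

Definition is_subgroup {H : Type} (mul : H -> H -> H) (inv : H -> H) (one : H)
  (G : H -> Prop) : Prop :=
  G one /\ (forall a b, G a -> G b -> G (mul a b)) /\ (forall a, G a -> G (inv a)).

(* Main.v *)
(* Let [F n] be closed subsets of the compactification separating [G] from the
   remainder.  Compactness says that for every open cover of [G] and every [x],
   some finite intersection of traces of the [F n] contains [x] and is covered by
   finitely many members; in particular [G] is Lindelöf.

   Upper bound.  Since [G] is Lindelöf, countably many translates of a small
   neighbourhood [V i] inside each member of a pseudobase at [one] cover [G], and
   these translates form a family [O] of [psi * omega] open sets such that
   distinct [x], [y] satisfy [x] in [O c], [y] in the exterior of [O c], for some
   [c].  Let [U] be open and [Z] closed with [x] in [int Z], [Z] inside [U].  A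
   Lindelöf argument on [Z * (G \ U)] shows that countably many [c] separate [Z]
   from [G \ U], and then [Z] is covered by countably many sets "finite
   intersection of the [F n] minus finitely many exteriors" contained in [U].  The
   interiors of countable unions of such sets are thus a base, of size [psi^omega].

   Equality of weights.  A base of [G] traces a local base at [one] in [H], and [H]
   is covered by countably many translates of each of its members; these
   translates form a base of [H].  This multiplies the size of the base by
   [omega], harmless when it is infinite; if [G] has a finite base then it is
   discrete, hence closed, hence all of [H]. *)
Require Import Defs.
From Stdlib Require Import List FinFun Arith Lia Cantor ClassicalEpsilon.
From Stdlib Require Import FunctionalExtensionality PropExtensionality ProofIrrelevance.
From mathcomp Require classical_sets.

Lemma choice {A B : Type} (R : A -> B -> Prop) :
  (forall a, exists b, R a b) -> exists f, forall a, R a (f a).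
Proof.
  intros h.
  exists (fun a => proj1_sig (constructive_indefinite_description _ (h a))).
  intros a. apply proj2_sig.
Qed.

(** * Cardinality *)

Definition embeds (A B : Type) : Prop := exists f : A -> B, injective f.

Lemma embeds_refl (A : Type) : embeds A A.
Proof. exists (fun a => a). intros a b h. exact h. Qed.

Lemma embeds_trans {A B D : Type} : embeds A B -> embeds B D -> embeds A D.
Proof.
  intros [f hf] [g hg]. exists (fun a => g (f a)).
  intros a b h. apply hf, hg, h.
Qed.

(** Points outside the image are sent to [a0]; with [B = nat] this enumerates [A], possibly with
    repetitions. *)
Lemma embeds_retract {A B : Type} (a0 : A) :
  embeds A B -> exists g : B -> A, forall a, exists b, g b = a.
Proof.
  intros [f hf].
  destruct (choice (fun b a => forall a', f a' = b -> a = a')) as [g hg].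
  - intros b. destruct (classic (exists a, f a = b)) as [[a ha] | h].
    + exists a. intros a' ha'. apply hf. congruence.
    + exists a0. intros a' ha'. exfalso. eauto.
  - exists g. intros a. exists (f a). apply hg. reflexivity.
Qed.

Lemma embeds_prod {A A' B B' : Type} :
  embeds A A' -> embeds B B' -> embeds (A * B) (A' * B').
Proof.
  intros [f hf] [g hg]. exists (fun p => (f (fst p), g (snd p))).
  intros [a b] [c d] h. injection h as h1 h2. f_equal; auto.
Qed.

Lemma embeds_fun {A B B' : Type} : embeds B B' -> embeds (A -> B) (A -> B').
Proof.
  intros [f hf]. exists (fun u a => f (u a)). intros u v h.
  apply functional_extensionality. intros a. apply hf.
  exact (f_equal (fun w => w a) h).
Qed.

Lemma embeds_fun_dom {A A' B : Type} (a0 : A) :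
  embeds A A' -> embeds (A -> B) (A' -> B).
Proof.
  intros h. destruct (embeds_retract a0 h) as [g hg].
  exists (fun u a' => u (g a')). intros u v huv.
  apply functional_extensionality. intros a. destruct (hg a) as [b <-].
  exact (f_equal (fun w => w b) huv).
Qed.

Lemma embeds_list {A B : Type} : embeds A B -> embeds (list A) (list B).
Proof.
  intros [f hf]. exists (map f). intros s.
  induction s as [|a s IH]; intros [|b t] h; try discriminate; auto.
  injection h as h1 h2. f_equal; auto.
Qed.

Lemma to_nat_injective : injective Cantor.to_nat.
Proof.
  intros a b h.
  rewrite <- (Cantor.cancel_of_to a), <- (Cantor.cancel_of_to b). congruence.
Qed.

Lemma embeds_nat_prod : embeds (nat * nat) nat.
Proof. exists Cantor.to_nat. exact to_nat_injective. Qed.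

Fixpoint list_code (s : list nat) : nat :=
  match s with
  | nil => 0
  | a :: t => S (Cantor.to_nat (a, list_code t))
  end.

Lemma embeds_list_nat : embeds (list nat) nat.
Proof.
  exists list_code.
  intros s. induction s as [|a s IH]; intros [|b t] h; try discriminate; auto.
  pose proof (to_nat_injective _ _ (eq_add_S _ _ h)) as e.
  injection e as -> e. f_equal. auto.
Qed.

Lemma embeds_seq_seq (P : Type) : embeds (nat -> nat -> P) (nat -> P).
Proof.
  apply (embeds_trans (B := (nat * nat -> P)%type)).
  - exists (fun u p => u (fst p) (snd p)). intros u v h.
    apply functional_extensionality. intros a.
    apply functional_extensionality. intros b.
    exact (f_equal (fun w => w (a, b)) h).
  - exact (embeds_fun_dom (0, 0) embeds_nat_prod).
Qed.

Lemma embeds_list_seq (P : Type) : embeds nat P -> embeds (list P) (nat -> P).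
Proof.
  intros [j hj].
  (* Position 0 stores the length, so the padding value [j 0] beyond the end causes no ambiguity. *)
  exists (fun s n => match n with 0 => j (length s) | S m => nth m s (j 0) end).
  intros s t h. apply nth_ext with (d := j 0) (d' := j 0).
  - apply hj. exact (f_equal (fun w => w 0) h).
  - intros n _. exact (f_equal (fun w => w (S n)) h).
Qed.

Lemma embeds_list_seqs (A P : Type) :
  embeds nat P -> embeds A (nat -> P) -> embeds (list A) (nat -> P).
Proof.
  intros hP hA.
  apply (embeds_trans (B := (list (nat -> P))%type)); [exact (embeds_list hA)|].
  apply (embeds_trans (B := (nat -> nat -> P)%type)); [|apply embeds_seq_seq].
  apply embeds_list_seq. destruct hP as [j hj]. exists (fun n _ => j n).
  intros a b h. apply hj. exact (f_equal (fun w => w 0) h).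
Qed.

Lemma embeds_prod_nat_seq (P : Type) : embeds nat P -> embeds (P * nat) (nat -> P).
Proof.
  intros [j hj].
  exists (fun p n => match n with 0 => fst p | _ => j (snd p) end).
  intros [p n] [q m] h.
  pose proof (f_equal (fun w => w 0) h) as h0.
  pose proof (f_equal (fun w => w 1) h) as h1.
  simpl in h0, h1. apply hj in h1. congruence.
Qed.

(** * Absorbing a countable factor into an infinite cardinal *)

Lemma infinite_subset {I : Type} (S : I -> Prop) :
  (forall l : list I, exists i, S i /\ ~ In i l) ->
  exists f : nat -> I, injective f /\ forall n, S (f n).
Proof.
  intros h. destruct (choice _ h) as [c hc].
  set (L := fix L n := match n with 0 => nil | Datatypes.S m => c (L m) :: L m end).
  assert (hL : forall n m, m < n -> In (c (L m)) (L n)).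
  { induction n as [|n IH]; intros m hm; [lia|].
    destruct (Nat.eq_dec m n) as [->|hne]; [now left|].
    right. apply IH. lia. }
  exists (fun n => c (L n)). split.
  - intros a b hab. destruct (lt_eq_lt_dec a b) as [[hlt|heq]|hlt]; auto.
    + exfalso. apply (proj2 (hc (L b))). rewrite <- hab. auto.
    + exfalso. apply (proj2 (hc (L a))). rewrite hab. auto.
  - intros n. apply hc.
Qed.

(** The case [g = g'] makes each member of [M] injective; distinct members have disjoint ranges. *)
Definition disjoint_sequences {I : Type} (M : (nat -> I) -> Prop) : Prop :=
  forall g g' n m, M g -> M g' -> g n = g' m -> g = g' /\ n = m.

Lemma maximal_disjoint_sequences (I : Type) :
  exists M : (nat -> I) -> Prop, disjoint_sequences M /\
    forall M', disjoint_sequences M' -> (forall g, M g -> M' g) ->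
      forall g, M' g -> M g.
Proof.
  destruct (classical_sets.Zorn_bigcup (P := @disjoint_sequences I))
    as [M [hM hmax]].
  - intros F hF tot g g' n m [A FA Ag] [B FB Bg'] e.
    destruct (tot A B FA FB) as [h|h].
    + exact (hF B FB g g' n m (h g Ag) Bg' e).
    + exact (hF A FA g g' n m Ag (h g' Bg') e).
  - exists M. split; [exact hM|]. intros M' hM' hle g hg.
    apply NNPP. intros hno. apply (hmax M'); [|exact hM'].
    split; [exact hle|]. intros h. exact (hno (h g hg)).
Qed.

(* Up to a finite remainder, an infinite set is a disjoint union of sequences. *)
Lemma infinite_prod_nat (I : Type) : embeds nat I -> embeds (I * nat) I.
Proof.
  intros [j hj].
  destruct (maximal_disjoint_sequences I) as [M [hM hmax]].
  set (R := fun i => forall g n, M g -> g n <> i).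
  assert (hfin : exists l, forall i, R i -> In i l).
  { apply NNPP. intros hno.
    destruct (infinite_subset R) as [f [hf hfR]].
    - intros l. apply NNPP. intros hno'. apply hno. exists l. intros i hi.
      apply NNPP. intros hil. apply hno'. eauto.
    (* A sequence inside the uncovered set [R] could be added to [M], so by maximality it is already
       there. *)
    - assert (Mf : M f).
      { apply (hmax (fun g => M g \/ g = f)); auto.
        intros g g' n m [hg| ->] [hg'| ->] e.
        - apply hM; auto.
        - exfalso. exact (hfR m g n hg e).
        - exfalso. exact (hfR n g' m hg' (eq_sym e)).
        - auto. }
      exact (hfR 0 f 0 Mf eq_refl). }
  destruct hfin as [l hl].
  assert (hg0 : exists g0, M g0).
  { apply NNPP. intros hno.
    assert (hincl : forall n, In (j n) l).
    { intros n. apply hl. intros g m hg. exfalso. eauto. }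
    assert (hlen : length (map j (seq 0 (S (length l)))) <= length l).
    { apply NoDup_incl_length.
      - apply FinFun.Injective_map_NoDup; [exact hj|apply seq_NoDup].
      - intros i hi. apply in_map_iff in hi. destruct hi as [n [<- _]]. auto. }
    rewrite length_map, length_seq in hlen. lia. }
  destruct hg0 as [g0 hg0].
  (* Covered points move to even positions of their own sequence, points of the remainder [l] to odd
     positions of [g0]; parity tells the two cases apart. *)
  destruct (choice (fun (p : I * nat) i =>
    (exists g n, M g /\ g n = fst p /\ i = g (2 * Cantor.to_nat (n, snd p))) \/
    (exists n, nth_error l n = Some (fst p) /\
       i = g0 (2 * Cantor.to_nat (n, snd p) + 1)))) as [f hf].
  { intros [i k]. simpl. destruct (classic (R i)) as [hi|hi].
    - destruct (In_nth_error _ _ (hl i hi)) as [n hn]. eexists. right. eauto.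
    - apply not_all_ex_not in hi. destruct hi as [g hi].
      apply not_all_ex_not in hi. destruct hi as [n hi].
      apply imply_to_and in hi. destruct hi as [hg hi]. apply NNPP in hi.
      eexists. left. eauto. }
  exists f. intros p q e.
  pose proof (hf p) as hp. pose proof (hf q) as hq. rewrite <- e in hq.
  destruct p as [a k], q as [b m]. cbn [fst snd] in hp, hq.
  destruct hp as [[g [n [Mg [gn ep]]]]|[n [ln ep]]];
  destruct hq as [[g' [n' [Mg' [gn' eq]]]]|[n' [ln' eq]]]; rewrite ep in eq.
  - apply hM in eq; auto. destruct eq as [<- eq].
    assert (eq' : Cantor.to_nat (n, k) = Cantor.to_nat (n', m)) by lia.
    pose proof (to_nat_injective _ _ eq') as e'. congruence.
  - apply hM in eq; auto. lia.
  - apply hM in eq; auto. lia.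
  - apply hM in eq; auto. destruct eq as [_ eq].
    assert (eq' : Cantor.to_nat (n, k) = Cantor.to_nat (n', m)) by lia.
    pose proof (to_nat_injective _ _ eq') as e'. congruence.
Qed.

(** * Lindelöf Σ-spaces *)

Lemma open_ext {X : Type} (T : topology X) (U V : X -> Prop) :
  T U -> (forall x, U x <-> V x) -> T V.
Proof.
  intros TU h. replace V with U; [exact TU|]. apply functional_extensionality.
  intros x. apply propositional_extensionality. apply h.
Qed.

Lemma open_of_nbhds {X : Type} (T : topology X) (U : X -> Prop) :
  is_topology T ->
  (forall x, U x -> exists V, T V /\ V x /\ forall y, V y -> U y) -> T U.
Proof.
  intros (_ & _ & hU) h.
  apply (open_ext T (fun x => exists V, (T V /\ forall y, V y -> U y) /\ V x)).
  - apply hU. tauto.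
  - intros x. split.
    + intros [V [[_ hV] Vx]]. auto.
    + intros hx. destruct (h x hx) as [V ?]. exists V. tauto.
Qed.

Lemma open_list_inter {X C : Type} (T : topology X) (O : C -> X -> Prop) (l : list C) :
  is_topology T -> (forall c, T (O c)) -> T (fun x => forall c, In c l -> O c x).
Proof.
  intros (hT & hI & _) hO. induction l as [|c l IH].
  - apply (open_ext T (fun _ => True)); [exact hT|]. simpl. tauto.
  - apply (open_ext T (fun x => O c x /\ forall c, In c l -> O c x)).
    + apply hI; auto.
    + intros x. split.
      * intros [h1 h2] d [<-|hd]; auto.
      * intros h. split; [apply h; now left|]. intros d hd. apply h. now right.
Qed.

Definition interior {X : Type} (T : topology X) (A : X -> Prop) : X -> Prop :=
  fun x => exists W, T W /\ W x /\ forall y, W y -> A y.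

Definition exterior {X : Type} (T : topology X) (A : X -> Prop) : X -> Prop :=
  interior T (fun x => ~ A x).

Lemma open_interior {X : Type} (T : topology X) (A : X -> Prop) :
  is_topology T -> T (interior T A).
Proof.
  intros hT. apply open_of_nbhds; [exact hT|]. intros x [W [TW [Wx hW]]].
  exists W. repeat split; auto. intros y Wy. exists W. auto.
Qed.

Lemma open_exterior {X : Type} (T : topology X) (A : X -> Prop) :
  is_topology T -> T (exterior T A).
Proof. exact (open_interior T (fun x => ~ A x)). Qed.

Definition meet {X : Type} (N : nat -> X -> Prop) (s : list nat) : X -> Prop :=
  fun x => forall n, In n s -> N n x.

(** The form of the Σ-property used from here on: a countable family on the space itself, with no
    reference to a compactification. *)
Definition sigma_network {X : Type} (T : topology X) (N : nat -> X -> Prop) : Prop :=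
  forall (C : Type) (O : C -> X -> Prop), (forall c, T (O c)) ->
    (forall y, exists c, O c y) ->
    forall x, exists s l, meet N s x /\
      forall y, meet N s y -> exists c, In c l /\ O c y.

Lemma lindelof_sigma_network {X : Type} (T : topology X) :
  lindelof_sigma T -> exists N, sigma_network T N.
Proof.
  intros [K [TK [e [[tK [cK [_ [[_ [_ emb]] _]]]] [F [hF sep]]]]]].
  exists (fun n y => F n (e y)). intros C O hO cov x.
  (* The cover of [K] has two kinds of members: those missing some [F n] that contains [e x], which
     catch the remainder, and those whose trace lies in some [O c]. *)
  destruct (cK (fun W => TK W /\ ((exists n, F n (e x) /\ forall z, W z -> ~ F n z) \/
    (exists c, forall y, W (e y) -> O c y)))) as [l [hl lcov]].
  - tauto.
  - intros z. destruct (classic (exists y, e y = z)) as [[y <-]|hz].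
    + destruct (cov y) as [c hc]. destruct (emb (O c) (hO c)) as [W [TW hW]].
      exists W. split; [|now apply hW]. split; [exact TW|]. right. exists c.
      intros y'. apply hW.
    + destruct (sep x z hz) as [n [h1 h2]]. exists (fun z => ~ F n z).
      split; [|exact h2]. split; [apply hF|]. left. exists n. auto.
  (* The finite subcover is sorted into indices [s] of the first kind and [l'] of the second; points
     of [meet N s] avoid the first kind. *)
  - assert (hs : exists s l', (forall n, In n s -> F n (e x)) /\ forall y,
      (exists W, In W l /\ W (e y)) ->
      (exists n, In n s /\ ~ F n (e y)) \/ (exists c, In c l' /\ O c y)).
    { clear lcov. induction l as [|W l IH].
      - exists nil, nil. split; [now intros n []|]. now intros y [W [[] _]].
      - destruct IH as [s [l' [h1 h2]]]; [intros U hU; apply hl; now right|].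
        destruct (hl W (or_introl eq_refl)) as [_ [[n [hn hW]]|[c hc]]].
        + exists (n :: s), l'. split.
          * intros m [<-|hm]; auto.
          * intros y [U [[<-|hU] Uy]].
            -- left. exists n. split; [now left|]. auto.
            -- destruct (h2 y) as [[m [hm hy]]|hy]; [eauto| |auto].
               left. exists m. split; [now right|exact hy].
        + exists s, (c :: l'). split; [exact h1|].
          intros y [U [[<-|hU] Uy]].
          * right. exists c. split; [now left|]. auto.
          * destruct (h2 y) as [hy|[d [hd hy]]]; [eauto|auto|].
            right. exists d. split; [now right|exact hy]. }
    destruct hs as [s [l' [h1 h2]]]. exists s, l'. split; [exact h1|].
    intros y hy. destruct (h2 y (lcov (e y))) as [[n [hn hny]]|h]; [|exact h].
    exfalso. exact (hny (hy n hn)).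
Qed.

Lemma sigma_network_lindelof {X C : Type} (T : topology X) (N : nat -> X -> Prop)
  (O : C -> X -> Prop) (c0 : C) :
  sigma_network T N -> (forall c, T (O c)) -> (forall y, exists c, O c y) ->
  exists f : nat -> C, forall y, exists n, O (f n) y.
Proof.
  intros hN hO cov.
  (* There are only countably many [s]; each receives a finite subcover of [meet N s], or [nil] if
     there is none. *)
  destruct (choice (fun s l => forall l', (forall y, meet N s y ->
    exists c, In c l' /\ O c y) -> forall y, meet N s y -> exists c, In c l /\ O c y))
    as [g hg].
  { intros s. destruct (classic (exists l', forall y, meet N s y ->
      exists c, In c l' /\ O c y)) as [[l hl]|h].
    - exists l. auto.
    - exists nil. intros l' hl'. exfalso. eauto. }
  destruct (@embeds_retract (list nat * nat) nat (nil, 0)) as [r hr].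
  { apply (embeds_trans (B := (nat * nat)%type)); [|apply embeds_nat_prod].
    apply embeds_prod; [apply embeds_list_nat|apply embeds_refl]. }
  exists (fun n => nth (snd (r n)) (g (fst (r n))) c0). intros y.
  destruct (hN C O hO cov y) as [s [l [hs hl]]].
  destruct (hg s l hl y hs) as [c [hc hy]].
  destruct (In_nth _ _ c0 hc) as [k [_ hk]].
  destruct (hr (s, k)) as [n hn]. exists n. rewrite hn. simpl. now rewrite hk.
Qed.

(** The complement of [V'] is a closed neighbourhood of [x] inside [U]; naming [V'] keeps an open
    set at hand for covers. *)
Definition regular {X : Type} (T : topology X) : Prop :=
  forall U x, T U -> U x -> exists V V', T V /\ T V' /\ V x /\
    (forall y, ~ U y -> V' y) /\ (forall y, V y -> V' y -> False).

(** * Bases from a countable network and a separating family *)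

Section SeparatingFamily.

Context {X C : Type} (T : topology X) (N : nat -> X -> Prop) (O : C -> X -> Prop).
Hypothesis hT : is_topology T.
Hypothesis hN : sigma_network T N.
Hypothesis hO : forall c, T (O c).
Hypothesis hsep : forall x y, x <> y -> exists c, O c x /\ exterior T (O c) y.

(* The two-variable Lindelöf argument at the pair [(x, x)]: each [a] in the closed
   set [Z = ~ V'] is separated from [~ U] near [x] by a finite list of exteriors,
   and finitely many [a] are enough near [x]. *)
Lemma finite_separation (U V' : X -> Prop) (x : X) :
  T U -> T V' -> (forall y, ~ U y -> V' y) ->
  exists s (E : list (list C)), meet N s x /\
    (forall z, meet N s z -> ~ V' z ->
       exists l, In l E /\ forall c, In c l -> O c z) /\
    (forall l z, In l E -> meet N s z ->
       (forall c, In c l -> ~ exterior T (O c) z) -> U z).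
Proof.
  intros TU TV' hUV.
  assert (step : forall a : {a | ~ V' a}, exists sl : list nat * list C,
    meet N (fst sl) x /\ (forall c, In c (snd sl) -> O c (proj1_sig a)) /\
    forall z, meet N (fst sl) z ->
      (forall c, In c (snd sl) -> ~ exterior T (O c) z) -> U z).
  { intros [a ha]. simpl.
    (* [None] stands for [U]; a point outside [U] differs from [a], since [a] lies outside [V'] and
       hence in [U]. *)
    destruct (hN (option {c | O c a}) (fun o => match o with
      | None => U | Some c => exterior T (O (proj1_sig c)) end)) with (x := x)
      as [s [l [hs hl]]].
    - intros [c|]; [apply open_exterior; exact hT|exact TU].
    - intros y. destruct (classic (U y)) as [hy|hy]; [now exists None|].
      destruct (hsep a y) as [c [h1 h2]].
      { intros <-. auto. }
      exists (Some (exist _ c h1)). exact h2.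
    - exists (s, flat_map (fun o => match o with
        | None => nil | Some c => proj1_sig c :: nil end) l). simpl.
      split; [exact hs|split].
      + intros c hc. apply in_flat_map in hc. destruct hc as [[[d hd]|] [_ hc]].
        * destruct hc as [<-|[]]. exact hd.
        * destruct hc.
      + intros z hz hext. destruct (hl z hz) as [[c|] [hc hzc]]; [|exact hzc].
        exfalso. apply (hext (proj1_sig c)); [|exact hzc].
        apply in_flat_map. exists (Some c). split; [exact hc|now left]. }
  destruct (choice _ step) as [f hf].
  destruct (hN (option {a | ~ V' a}) (fun o => match o with
    | None => V' | Some a => fun z => forall c, In c (snd (f a)) -> O c z end))
    with (x := x) as [t [l [ht hl]]].
  - intros [a|]; [apply open_list_inter; auto|exact TV'].
  - intros y. destruct (classic (V' y)) as [hy|hy]; [now exists None|].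
    exists (Some (exist _ y hy)). apply (hf (exist _ y hy)).
  - set (l' := flat_map (fun o => match o with None => nil | Some a => a :: nil end) l).
    exists (t ++ flat_map (fun a => fst (f a)) l'), (map (fun a => snd (f a)) l').
    split; [|split].
    + intros n hn. apply in_app_or in hn. destruct hn as [hn|hn]; [auto|].
      apply in_flat_map in hn. destruct hn as [a [_ hn]]. now apply (hf a).
    + intros z hz hV. destruct (hl z) as [[a|] [ha hza]].
      * intros n hn. apply hz, in_or_app. now left.
      * exists (snd (f a)). split; [|exact hza].
        apply (in_map (fun a => snd (f a))). apply in_flat_map.
        exists (Some a). split; [exact ha|now left].
      * contradiction.
    + intros k z hk hz hext. apply in_map_iff in hk. destruct hk as [a [<- ha]].
      apply (hf a); [|exact hext]. intros n hn. apply hz, in_or_app. right.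
      apply in_flat_map. eauto.
Qed.

(* The basic open set of the code [E] is the interior of the union, over [s] and
   [l] in [E s], of [meet N s] minus the exteriors of the [O c], [c] in [l]. *)
Lemma weight_le_separating_family :
  regular T -> weight_le T (list nat -> list (list C)).
Proof.
  intros hreg.
  exists (list nat -> list (list C)), (fun E => interior T (fun z =>
    exists s l, In l (E s) /\ meet N s z /\
      forall c, In c l -> ~ exterior T (O c) z)).
  split; [|split; [|apply embeds_refl]].
  { intros E. apply open_interior, hT. }
  intros U TU x Ux. destruct (hreg U x TU Ux) as [V [V' [TV [TV' [Vx [hUV dis]]]]]].
  (* [E s] is chosen from [U] and [V'] alone, so one code serves all points of [V]; it is [nil] when
     no list works for [s]. *)
  destruct (choice (fun s E =>
    (forall l z, In l E -> meet N s z ->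
       (forall c, In c l -> ~ exterior T (O c) z) -> U z) /\
    (forall z, meet N s z -> ~ V' z ->
      (exists E', (forall z, meet N s z -> ~ V' z ->
       exists l, In l E' /\ forall c, In c l -> O c z) /\
      (forall l z, In l E' -> meet N s z ->
       (forall c, In c l -> ~ exterior T (O c) z) -> U z)) ->
      exists l, In l E /\ forall c, In c l -> O c z))) as [E hE].
  { intros s. match goal with |- exists _, _ /\ (forall _, _ -> _ -> ?P -> _) =>
      destruct (classic P) as [[E [h1 h2]]|h] end.
    - exists E. auto.
    - exists nil. split; [now intros l z []|]. intros z _ _ h'. contradiction. }
  exists E. split.
  - exists V. repeat split; auto. intros z Vz.
    destruct (finite_separation U V' z TU TV' hUV) as [s [E' [hs hE']]].
    destruct (proj2 (hE s) z hs) as [l [hl hz]]; [eauto|eauto|].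
    exists s, l. repeat split; auto. intros c hc [W [_ [Wz hW]]].
    exact (hW z Wz (hz c hc)).
  - intros y [W [_ [Wy hW]]]. destruct (hW y Wy) as [s [l [hl [hy hext]]]].
    exact (proj1 (hE s) l y hl hy hext).
Qed.

End SeparatingFamily.

Lemma weight_le_embeds {X K K' : Type} (T : topology X) :
  weight_le T K -> embeds K K' -> weight_le T K'.
Proof.
  intros [I [B [h1 [h2 h3]]]] h. exists I, B. split; [exact h1|split; [exact h2|]].
  exact (embeds_trans h3 h).
Qed.

(** * Topological groups *)

Section TopologicalGroup.

Context {X : Type} (T : topology X) (mul : X -> X -> X) (inv : X -> X) (one : X).
Hypothesis hX : is_topological_group T mul inv one.

Local Notation "x * y" := (mul x y).
Local Notation "x ^-1" := (inv x) (at level 3, format "x ^-1").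

Lemma mulA x y z : x * (y * z) = x * y * z.
Proof. apply hX. Qed.

Lemma mul1g x : one * x = x.
Proof. apply hX. Qed.

Lemma mulg1 x : x * one = x.
Proof. apply hX. Qed.

Lemma mulVg x : x^-1 * x = one.
Proof. apply hX. Qed.

Lemma mulgV x : x * x^-1 = one.
Proof. apply hX. Qed.

Lemma mulKg x y : x^-1 * (x * y) = y.
Proof. now rewrite mulA, mulVg, mul1g. Qed.

Lemma mulKVg x y : x * (x^-1 * y) = y.
Proof. now rewrite mulA, mulgV, mul1g. Qed.

Lemma invg_uniq x y : x * y = one -> x^-1 = y.
Proof. intros h. rewrite <- (mulKg x y), h. now rewrite mulg1. Qed.

Lemma invgK x : x^-1^-1 = x.
Proof. apply invg_uniq, mulVg. Qed.

Lemma invMg x y : (x * y)^-1 = y^-1 * x^-1.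
Proof. apply invg_uniq. now rewrite <- mulA, mulKVg, mulgV. Qed.

Lemma open_translate U a : T U -> T (fun x => U (a * x)).
Proof.
  destruct hX as (hT & _ & hmul & _). intros TU.
  apply open_of_nbhds; [exact hT|]. intros x hx.
  destruct (hmul U TU (a, x) hx) as [V [W [_ [TW [Va [Wx h]]]]]].
  exists W. repeat split; auto. intros y Wy. exact (h (a, y) Va Wy).
Qed.

Lemma small_nbhd U : T U -> U one -> exists V, T V /\ V one /\
  (forall a, V a -> V a^-1) /\ forall a b c, V a -> V b -> V c -> U (a * b * c).
Proof.
  destruct hX as (hT & _ & hmul & hinv).
  assert (square : forall U, T U -> U one -> exists V, T V /\ V one /\
    forall a b, V a -> V b -> U (a * b)).
  { intros W TW W1. destruct (hmul W TW (one, one)) as [A [B [TA [TB [A1 [B1 h]]]]]].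
    - simpl. now rewrite mul1g.
    - exists (fun x => A x /\ B x). split; [now apply hT|]. split; [auto|].
      intros a b [Aa _] [_ Bb]. exact (h (a, b) Aa Bb). }
  intros TU U1. destruct (square U TU U1) as [V [TV [V1 hV]]].
  destruct (square V TV V1) as [W [TW [W1 hW]]].
  exists (fun x => W x /\ W x^-1). split; [|split; [|split]].
  - apply hT; [exact TW|exact (hinv W TW)].
  - rewrite (invg_uniq one one); auto. apply mul1g.
  - intros a [h1 h2]. now rewrite invgK.
  - intros a b c [ha _] [hb _] [hc _]. apply hV; [auto|].
    (* [W] is small enough for four factors; [c] counts as the two factors [c * one]. *)
    rewrite <- (mulg1 c). auto.
Qed.

Lemma group_regular : regular T.
Proof.
  intros U x TU Ux. pose proof hX as (hT & _).
  destruct (small_nbhd (fun a => U (x * a))) as [V [TV [V1 [Vinv hV]]]].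
  { now apply open_translate. }
  { now rewrite mulg1. }
  exists (fun y => V (x^-1 * y)), (fun z => exists y, ~ U y /\ V (y^-1 * z)).
  split; [now apply open_translate|]. split; [|split; [|split]].
  - apply open_of_nbhds; [exact hT|]. intros z [y [hy hz]].
    exists (fun z => V (y^-1 * z)). split; [now apply open_translate|]. eauto.
  - now rewrite mulVg.
  - intros y hy. exists y. now rewrite mulVg.
  - intros z hz [y [hy hyz]]. apply hy.
    rewrite <- (mulKVg x y), <- (mulg1 (x^-1 * y)).
    replace (x^-1 * y) with (x^-1 * z * (y^-1 * z)^-1); [now auto|].
    now rewrite invMg, invgK, <- mulA, mulKVg.
Qed.

Lemma separating_family N P : sigma_network T N -> psi_le T P ->
  exists (C : Type) (O : C -> X -> Prop), embeds C (P * nat) /\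
    (forall c, T (O c)) /\
    forall x y, x <> y -> exists c, O c x /\ exterior T (O c) y.
Proof.
  intros hN hpsi. destruct (hpsi one) as [I [U [hU [hU1 hI]]]].
  destruct (choice _ (fun i => small_nbhd (U i) (proj1 (hU i)) (proj2 (hU i))))
    as [V hV].
  destruct (choice (fun i (d : nat -> X) => forall y, exists n, V i ((d n)^-1 * y)))
    as [d hd].
  { intros i. destruct (hV i) as [TV [V1 _]].
    apply (sigma_network_lindelof T N (fun c y => V i (c^-1 * y)) one hN).
    - intros c. now apply open_translate.
    - intros y. exists y. now rewrite mulVg. }
  exists (prod I nat), (fun c y => V (fst c) ((d (fst c) (snd c))^-1 * y)).
  split; [apply embeds_prod; [exact hI|apply embeds_refl]|]. split.
  - intros c. apply open_translate, hV.
  - intros x y hxy.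
    assert (hi : exists i, ~ U i (x^-1 * y)).
    { apply not_all_ex_not. intros h. apply hxy. apply hU1 in h.
      now rewrite <- (mulKVg x y), h, mulg1. }
    destruct hi as [i hi]. destruct (hV i) as [TV [V1 [Vinv hVi]]].
    destruct (hd i x) as [n hn]. exists (i, n). split; [exact hn|].
    exists (fun z => V i (y^-1 * z)). split; [now apply open_translate|].
    split; [now rewrite mulVg|]. simpl. intros z hyz hz. apply hi.
    (* Passing through [d i n] and [z] writes [x^-1 * y] as a product of three elements of [V i],
       which lands in [U i]. *)
    replace (x^-1 * y) with
      (((d i n)^-1 * x)^-1 * ((d i n)^-1 * z) * (y^-1 * z)^-1); [now auto|].
    rewrite !invMg, !invgK, <- !mulA. now rewrite !mulKVg.
Qed.

Lemma weight_le_psi P : lindelof_sigma T -> embeds nat P -> psi_le T P ->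
  weight_le T (nat -> P).
Proof.
  intros hLS hP hpsi. destruct (lindelof_sigma_network T hLS) as [N hN].
  destruct (separating_family N P hN hpsi) as [C [O [hC [hO hsep]]]].
  (* [C] and all finite lists over it fit into [nat -> P], and a countable power of [nat -> P] fits
     into it again. *)
  apply (weight_le_embeds (K := (list nat -> list (list C))%type)).
  - apply (weight_le_separating_family T N O); auto; [apply hX|apply group_regular].
  - apply (embeds_trans (B := nat -> nat -> P)); [|apply embeds_seq_seq].
    apply (embeds_trans (B := list nat -> nat -> P)).
    + apply embeds_fun. apply embeds_list_seqs, embeds_list_seqs; auto.
      exact (embeds_trans hC (embeds_prod_nat_seq P hP)).
    + exact (embeds_fun_dom nil embeds_list_nat).
Qed.

(** * Dense subgroups *)

Variable G : X -> Prop.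
Hypothesis hG : is_subgroup mul inv one G.
Hypothesis hGd : dense T G.
Hypothesis hHaus : hausdorff T.

Lemma subgroup_topological_group :
  exists mul' inv' one', is_topological_group (subspace T G) mul' inv' one'.
Proof.
  destruct hG as [G1 [GM GV]]. pose proof hX as ((hT & hI & hU) & _ & hmul & hinv).
  assert (val_inj : forall a b : {x | G x}, proj1_sig a = proj1_sig b -> a = b).
  { intros [a ha] [b hb] e. simpl in e. subst b. f_equal. apply proof_irrelevance. }
  exists (fun a b => exist _ (proj1_sig a * proj1_sig b)
    (GM _ _ (proj2_sig a) (proj2_sig b))).
  exists (fun a => exist _ (proj1_sig a)^-1 (GV _ (proj2_sig a))).
  exists (exist _ one G1).
  split; [|split; [|split]].
  - split; [|split].
    + exists (fun _ => True). split; [exact hT|]. tauto.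
    + intros U V [U' [TU hU']] [V' [TV hV']]. exists (fun x => U' x /\ V' x).
      split; [auto|]. intros x. specialize (hU' x). specialize (hV' x). tauto.
    (* Gathering all ambient open sets whose traces belong to [F] avoids choosing one for each
       member. *)
    + intros F hF. exists (fun x => exists V, (T V /\ exists U, F U /\
        forall y, U y <-> V (proj1_sig y)) /\ V x). split.
      * apply hU. tauto.
      * intros x. split.
        -- intros [U [FU Ux]]. destruct (hF U FU) as [V [TV hV]].
           exists V. split; [eauto|]. now apply hV.
        -- intros [V [[_ [U [FU h]]] Vx]]. exists U. split; [exact FU|].
           now apply h.
  - split; [|split; [|split; [|split]]]; intros; apply val_inj; simpl.
    + apply mulA.
    + apply mul1g.
    + apply mulg1.
    + apply mulVg.
    + apply mulgV.
  - intros V [V' [TV hV]] [a b] hab. apply hV in hab. simpl in hab.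
    destruct (hmul V' TV (proj1_sig a, proj1_sig b) hab)
      as [A [B [TA [TB [Aa [Bb h]]]]]].
    exists (fun x => A (proj1_sig x)), (fun x => B (proj1_sig x)).
    split; [now exists A|]. split; [now exists B|]. repeat split; auto.
    intros [c d] Ac Bd. apply hV. exact (h (proj1_sig c, proj1_sig d) Ac Bd).
  - intros V [V' [TV hV]]. exists (fun x => V' x^-1). split; [exact (hinv V' TV)|].
    intros x. apply hV.
Qed.

(** By density each [x] is close to some [g] in [G], and [g] lies in one of countably many
    translates of [V] covering [G]; hence [x] lies in a translate of [V * V^-1]. *)
Lemma narrow_of_dense_subgroup N W : sigma_network (subspace T G) N -> T W -> W one ->
  exists d : nat -> X, forall x, exists n, W ((d n)^-1 * x).
Proof.
  intros hN TW W1. destruct (small_nbhd W TW W1) as [V [TV [V1 [Vinv hV]]]].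
  destruct (sigma_network_lindelof (subspace T G) N
    (fun (c : {x | G x}) y => V ((proj1_sig c)^-1 * proj1_sig y))
    (exist _ one (proj1 hG)) hN) as [f hf].
  - intros c. exists (fun y => V ((proj1_sig c)^-1 * y)).
    split; [now apply open_translate|tauto].
  - intros y. exists y. now rewrite mulVg.
  - exists (fun n => proj1_sig (f n)). intros x.
    destruct (hGd (fun g => V (x^-1 * g))) as [g [hxg Gg]].
    + now apply open_translate.
    + exists x. now rewrite mulVg.
    + destruct (hf (exist _ g Gg)) as [n hn]. simpl in hn. exists n.
      set (u := proj1_sig (f n)) in *.
      replace (u^-1 * x) with (u^-1 * g * (x^-1 * g)^-1 * one); [now auto|].
      now rewrite mulg1, invMg, invgK, <- mulA, mulKVg.
Qed.

(** [B' i] may exceed its trace, but by density it stays in the closure of that trace, and the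
    closure of a small trace is still small. *)
Lemma local_base_of_dense_subgroup I (B : I -> {x | G x} -> Prop) (B' : I -> X -> Prop) :
  (forall U, subspace T G U -> forall x, U x ->
     exists i, B i x /\ forall y, B i y -> U y) ->
  (forall i, T (B' i) /\ forall x, B i x <-> B' i (proj1_sig x)) ->
  forall U, T U -> U one -> exists i, B' i one /\ forall x, B' i x -> U x.
Proof.
  intros hB hB' U TU U1. destruct (small_nbhd U TU U1) as [V [TV [V1 [Vinv hV]]]].
  destruct (hB (fun x => V (proj1_sig x))) with (x := exist G one (proj1 hG))
    as [i [hi hiV]].
  - exists V. split; [exact TV|tauto].
  - exact V1.
  - exists i. destruct (hB' i) as [TB hBi]. split; [exact (proj1 (hBi _) hi)|].
    intros x hx.
    destruct (hGd (fun g => V (x^-1 * g) /\ B' i g)) as [g [[hxg hg] Gg]].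
    + apply hX; [now apply open_translate|exact TB].
    + exists x. now rewrite mulVg.
    + assert (Vg : V g) by (apply (hiV (exist _ g Gg)), hBi, hg).
      replace x with (g * (x^-1 * g)^-1 * one); [now auto|].
      now rewrite mulg1, invMg, invgK, mulKVg.
Qed.

(** A point of [V] other than [one] would have a neighbourhood in [V] that misses [one] yet meets
    [G]. So [V] is a singleton, and so are its translates, each of which meets [G]. *)
Lemma discrete_dense_subgroup V :
  T V -> V one -> (forall x, V x -> G x -> x = one) -> forall x, G x.
Proof.
  intros TV V1 hV.
  assert (V_one : forall x, V x -> x = one).
  { intros x Vx. apply NNPP. intros hx.
    destruct (hHaus x one hx) as [A [B [TA [TB [Ax [B1 dis]]]]]].
    destruct (hGd (fun y => V y /\ A y)) as [g [[Vg Ag] Gg]]; [now apply hX|eauto|].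
    rewrite (hV g Vg Gg) in Ag. eauto. }
  intros x. destruct (hGd (fun g => V (x^-1 * g))) as [g [hg Gg]].
  - now apply open_translate.
  - exists x. now rewrite mulVg.
  - apply V_one in hg. rewrite <- (mulKVg x g), hg, mulg1 in Gg. exact Gg.
Qed.

Lemma subspace_weight_le K : weight_le T K -> weight_le (subspace T G) K.
Proof.
  intros [I [B [h1 [h2 h3]]]]. exists I, (fun i x => B i (proj1_sig x)).
  split; [|split; [|exact h3]].
  - intros i. exists (B i). split; [auto|tauto].
  - intros U [V [TV hV]] x Ux. apply hV in Ux.
    destruct (h2 V TV _ Ux) as [i [hi hiV]]. exists i. split; [exact hi|].
    intros y hy. apply hV. auto.
Qed.

Lemma dense_subgroup_weight_le N K :
  sigma_network (subspace T G) N -> weight_le (subspace T G) K -> weight_le T K.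
Proof.
  intros hN [I [B [h1 [h2 h3]]]]. destruct (choice _ h1) as [B' hB'].
  pose proof (local_base_of_dense_subgroup I B B' h2 hB') as base.
  destruct (classic (exists l : list I, forall i, In i l)) as [[l hl]|hinf].
  - assert (hGX : forall x, G x).
    { apply (discrete_dense_subgroup (fun x => forall i, In i l -> B' i one -> B' i x)).
      - apply open_of_nbhds; [apply hX|]. intros x hx.
        (* Sets missing [one] are replaced by the whole space, making this a plain finite
           intersection. *)
        exists (fun y => forall i, In i l -> (if excluded_middle_informative (B' i one)
          then B' i else fun _ => True) y).
        split; [|split].
        + apply open_list_inter; [apply hX|]. intros i.
          destruct (excluded_middle_informative (B' i one)); [apply hB'|apply hX].
        + intros i hi. destruct (excluded_middle_informative (B' i one)); auto.
        + intros y hy i hi hi1. specialize (hy i hi).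
          destruct (excluded_middle_informative (B' i one)); tauto.
      - auto.
      - intros x hx _. apply NNPP. intros hne.
        destruct (hHaus x one hne) as [A [C [TA [TC [Ax [C1 dis]]]]]].
        destruct (base C TC C1) as [i [hi hiC]]. eauto. }
    exists I, B'. split; [intros i; apply hB'|]. split; [|exact h3].
    intros U TU x Ux.
    destruct (h2 (fun y => U (proj1_sig y))) with (x := exist G x (hGX x))
      as [i [hi hiU]]; [|exact Ux|].
    + exists U. split; [exact TU|tauto].
    + exists i. split; [exact (proj1 (proj2 (hB' i) _) hi)|]. intros y hy.
      apply (hiU (exist _ y (hGX y))), hB', hy.
  - assert (hI : embeds (prod I nat) I).
    { apply infinite_prod_nat. destruct (infinite_subset (fun _ : I => True))
        as [f [hf _]].
      - intros l. apply NNPP. intros hno. apply hinf. exists l. intros i.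
        apply NNPP. intros hi. apply hno. eauto.
      - exists f. exact hf. }
    apply (weight_le_embeds (K := (prod I nat)%type)); [|exact (embeds_trans hI h3)].
    destruct (choice (fun i (d : nat -> X) =>
      B' i one -> forall x, exists n, B' i ((d n)^-1 * x))) as [d hd].
    { intros i. destruct (classic (B' i one)) as [hi|hi].
      - destruct (narrow_of_dense_subgroup N (B' i) hN) as [d hd];
          [apply hB'|exact hi|]. now exists d.
      - exists (fun _ => one). contradiction. }
    exists (prod I nat), (fun c x => B' (fst c) ((d (fst c) (snd c))^-1 * x)).
    split; [|split; [|apply embeds_refl]].
    { intros c. apply open_translate, hB'. }
    intros U TU x Ux. destruct (small_nbhd (fun a => U (x * a))) as [V [TV [V1 [Vinv hV]]]].
    { now apply open_translate. }
    { now rewrite mulg1. }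
    destruct (base V TV V1) as [i [hi hiV]].
    (* The translate of [B' i] by [d i n] contains [x], so it is contained in [x * V^-1 * V]. *)
    destruct (hd i hi x) as [n hn]. exists (i, n). split; [exact hn|].
    simpl. intros y hy. rewrite <- (mulKVg x y), <- (mulg1 (x^-1 * y)).
    replace (x^-1 * y) with (((d i n)^-1 * x)^-1 * ((d i n)^-1 * y)); [now auto|].
    now rewrite invMg, invgK, <- mulA, mulKVg.
Qed.

End TopologicalGroup.

Theorem theorem3 (H : Type) (TH : topology H) (mul : H -> H -> H) (inv : H -> H)
  (one : H) (HTG : is_topological_group TH mul inv one) (HHaus : hausdorff TH)
  (G : H -> Prop) (HG : is_subgroup mul inv one G) (HGd : dense TH G)
  (HLS : lindelof_sigma (subspace TH G)) :
  (forall K : Type, weight_le TH K <-> weight_le (subspace TH G) K) /\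
  (forall P : Type, (exists f : nat -> P, injective f) ->
     psi_le (subspace TH G) P -> weight_le (subspace TH G) (nat -> P)).
Proof.
  split.
  - intros K. split; [apply subspace_weight_le|].
    destruct (lindelof_sigma_network _ HLS) as [N hN].
    exact (dense_subgroup_weight_le TH mul inv one HTG G HG HGd HHaus N K hN).
  - intros P hP hpsi.
    (* The upper bound is proved for a topological group in its own right, here [G] with the
       subspace topology. *)
    destruct (subgroup_topological_group TH mul inv one HTG G HG)
      as [mul' [inv' [one' hG]]].
    exact (weight_le_psi _ mul' inv' one' hG P HLS hP hpsi).
Qed.
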